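(* Let $n\ge5$ be odd. Let $D,H,G$ be the test semirings defined in the context and $\mathcal W$ the variety generated by $\{H,D,G\}$. For distinct variables $x_1,\ldots,x_n,y_1,\ldots,y_n,z$ (with $y_{n+1}=y_1$), put, in the free commutative ai-semiring, \[ p_n=x_1x_2\cdots x_n,\quad a_n=x_1z,\quad q_n=p_nz,\quad b_i=x_iy_iy_{i+1}z\ (1\le i\le n),\quad U_n=p_n+a_n+\sum_{i=1}^n b_i . \] Let $s$ be a polynomial and $r$ a commutative word such that the absorption identity $s+r\approx s$ is valid in $\mathcal W$. Suppose that this identity has a contextual application from $U_n$ to $U_n+q_n$, that is, there are a substitution $\varphi$, a multiplicative context $K$ (a polynomial or absent) and an additive context $R$ (a polynomial or absent) such that $U_n$ and $U_n+q_n$ are, in one order or the other, the two polynomials \[ K\varphi(s)+R\qquad\text{and}\qquad K\varphi(s)+K\varphi(r)+R . \] Then $r$ contains at least $n+1$ distinct variables.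
   Context: A semiring is a nonempty algebra $(S,+,\cdot)$ (no constants) in which both operations are associative and multiplication distributes over addition on both sides. An ai-semiring is a semiring whose addition is commutative and idempotent; it is commutative if its multiplication is commutative as well. Let $X$ be a countably infinite set of variables (containing all those used) and $X_c^+$ the free commutative semigroup on $X$; its elements are called commutative words (nonempty, determined by the multiplicity of each variable). A polynomial is a finite nonempty subset of $X_c^+$, written as the formal sum of its words. With union as addition and setwise multiplication of words as product, polynomials form the free commutative ai-semiring on $X$. A substitution sends each variable to a (nonempty) polynomial and extends to an endomorphism of the free commutative ai-semiring. When $K$ (respectively $R$) is absent, the corresponding factor (respectively summand) is simply omitted. Test semirings (element names are labels, not constants). $D=\{0,1\}$ is the two-element distributive lattice, with join as addition and meet as multiplication. $H=\{1,a,\infty\}$ has addition equal to the join in the chain $1<a<\infty$, and its commutative multiplication has identity $1$, $a\cdot a=\infty$, and $\infty$ absorbing. $G=\{1,g,\infty\}$ has addition $x+x=x$ and $x+y=\infty$ for $x\ne y$, and its commutative multiplication has identity $1$, $g\cdot g=1$, and $\infty$ absorbing. All three are commutative ai-semirings. *)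

(* Defs.v *)
From HB Require Import structures.
From mathcomp Require Import all_boot.
From mathcomp.finmap Require Import finmap multiset.

Set Implicit Arguments.
Unset Strict Implicit.
Unset Printing Implicit Defensive.

Local Open Scope fset_scope.

Record caisemiring : Type := CaiSemiring {
  carrier :> Type;
  sadd : carrier -> carrier -> carrier;
  smul : carrier -> carrier -> carrier;
  s_inhab : inhabited carrier;
  saddA : associative sadd;
  saddC : commutative sadd;
  saddxx : idempotent_op sadd;
  smulA : associative smul;
  smulC : commutative smul;
  smulDl : left_distributive smul sadd;
  smulDr : right_distributive smul sadd
}.

Definition is_hom (S T : caisemiring) (f : S -> T) : Prop :=
  {morph f : a b / sadd a b >-> sadd a b} /\
  {morph f : a b / smul a b >-> smul a b}.

Definition caiclass := caisemiring -> Prop.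

(* Classes of commutative ai-semirings only: the three generators below are
   commutative, hence so is every member of the variety they generate.
   Subalgebras and direct products are taken up to isomorphism: a subalgebra
   is the domain of an injective homomorphism, and P is a direct product of
   the family S when some homomorphisms P -> S i induce a bijection from P
   onto the Cartesian product of the S i. *)
Definition hom_closed (V : caiclass) : Prop :=
  forall (S T : caisemiring) (f : S -> T),
    is_hom f -> (forall t, exists s, f s = t) -> V S -> V T.

Definition sub_closed (V : caiclass) : Prop :=
  forall (S T : caisemiring) (f : S -> T),
    is_hom f -> injective f -> V T -> V S.

Definition is_product (I : Type) (S : I -> caisemiring) (P : caisemiring)
    (pr : forall i, P -> S i) : Prop :=
  [/\ forall i, is_hom (pr i),
      forall a b, (forall i, pr i a = pr i b) -> a = b
    & forall c : (forall i, S i), exists a, forall i, pr i a = c i].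

Definition prod_closed (V : caiclass) : Prop :=
  forall (I : Type) (S : I -> caisemiring) (P : caisemiring)
    (pr : forall i, P -> S i),
    is_product pr -> (forall i, V (S i)) -> V P.

Definition is_variety (V : caiclass) : Prop :=
  [/\ hom_closed V, sub_closed V & prod_closed V].

Definition generated_variety (C : caiclass) : caiclass :=
  fun S => forall V : caiclass,
    is_variety V -> (forall T, C T -> V T) -> V S.

Definition var := nat.

Definition cword := {w : {mset var}%mset | w != mset0}.

Definition poly := {p : {fset cword} | p != fset0}.

Definition wvars (w : cword) : {fset var} := finsupp (val w).

Fact wmul_subproof (u v : cword) : (val u `+` val v)%mset != mset0.
Proof.
apply: contraNneq (valP u) => /msetP uv0; apply/eqP/msetP => a.
by have := uv0 a; rewrite msetE2 !mset0E; case: (val u a).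
Qed.
Definition wmul (u v : cword) : cword := Sub (val u `+` val v)%mset
  (wmul_subproof u v).

Fact seq_word_subproof (a : var) (s : seq var) : seq_mset (a :: s) != mset0.
Proof. by apply/eqP => /msetP/(_ a); rewrite mset_seqE mset0E /= eqxx. Qed.
(* The first factor is separate so that the word is nonempty. *)
Definition seq_word (a : var) (s : seq var) : cword :=
  Sub (seq_mset (a :: s)) (seq_word_subproof a s).

Fact mono_subproof (w : cword) : [fset w] != fset0.
Proof. by apply/fset0Pn; exists w; rewrite inE. Qed.
Definition mono (w : cword) : poly := Sub [fset w] (mono_subproof w).

Fact padd_subproof (p q : poly) : (val p `|` val q) != fset0.
Proof.
by case/fset0Pn: (valP p) => w wp; apply/fset0Pn; exists w; rewrite inE wp.
Qed.
Definition padd (p q : poly) : poly :=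
  Sub (val p `|` val q) (padd_subproof p q).

Fact pmul_subproof (p q : poly) :
  [fset wmul u v | u in val p, v in val q] != fset0.
Proof.
case/fset0Pn: (valP p) => u up; case/fset0Pn: (valP q) => v vq.
by apply/fset0Pn; exists (wmul u v); apply: in_imfset2.
Qed.
Definition pmul (p q : poly) : poly :=
  Sub [fset wmul u v | u in val p, v in val q] (pmul_subproof p q).

Lemma wmulC : commutative wmul.
Proof. by move=> u v; apply/val_inj/msetDC. Qed.

Lemma wmulA : associative wmul.
Proof. by move=> u v w; apply/val_inj/msetDA. Qed.

Lemma paddA : associative padd.
Proof. by move=> p q r; apply/val_inj/fsetUA. Qed.

Lemma paddC : commutative padd.
Proof. by move=> p q; apply/val_inj/fsetUC. Qed.

Lemma paddxx : idempotent_op padd.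
Proof. by move=> p; apply/val_inj/fsetUid. Qed.

Lemma in_pmulP (p q : poly) (w : cword) :
  reflect (exists u v, [/\ u \in val p, v \in val q & w = wmul u v])
          (w \in val (pmul p q)).
Proof.
apply: (iffP idP) => [/imfset2P[u up [v vq ->]]|[u [v [up vq ->]]]].
  by exists u, v.
exact: in_imfset2.
Qed.

Lemma pmulC : commutative pmul.
Proof.
move=> p q; apply/val_inj/fsetP => w.
by apply/in_pmulP/in_pmulP => -[u [v [? ? ->]]]; exists v, u; rewrite wmulC.
Qed.

Lemma pmulA : associative pmul.
Proof.
move=> p q r; apply/val_inj/fsetP => w; apply/in_pmulP/in_pmulP.
  move=> [u [_ [up /in_pmulP[v [t [vq tr ->]]] ->]]].
  exists (wmul u v), t; rewrite wmulA; split=> //.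
  by apply/in_pmulP; exists u, v.
move=> [_ [t [/in_pmulP[u [v [up vq ->]]] tr ->]]].
exists u, (wmul v t); rewrite wmulA; split=> //.
by apply/in_pmulP; exists v, t.
Qed.

Lemma pmulDl : left_distributive pmul padd.
Proof.
move=> p q r; apply/val_inj/fsetP => w; apply/in_pmulP/idP.
  move=> [u [v [+ vr ->]]]; rewrite !inE.
  by case/orP => ?; apply/orP; [left|right]; apply/in_pmulP; exists u, v.
rewrite inE => /orP[] /in_pmulP[u [v [uP vr ->]]]; exists u, v;
  by rewrite inE uP ?orbT.
Qed.

Lemma pmulDr : right_distributive pmul padd.
Proof. by move=> p q r; rewrite pmulC pmulDl !(pmulC p). Qed.

Definition free_cai : caisemiring :=
  CaiSemiring (inhabits (mono (seq_word 0 [::])))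
    paddA paddC paddxx pmulA pmulC pmulDl pmulDr.

(* The iterated operation over a nonempty finite sequence; the value x0 is
   returned only on the empty sequence. *)
Definition bigne (T I : Type) (op : T -> T -> T) (opA : associative op)
    (opC : commutative op) (x0 : T) (s : seq I) (F : I -> T) : T :=
  odflt x0 (\big[oAC opA opC/None]_(i <- s) Some (F i)).

(* The default v 0 below is never used, words and polynomials being nonempty. *)
Definition weval (S : caisemiring) (v : var -> S) (w : cword) : S :=
  bigne (@smulA S) (@smulC S) (v 0) (enum_mset (val w)) v.

Definition peval (S : caisemiring) (v : var -> S) (p : poly) : S :=
  bigne (@saddA S) (@saddC S) (v 0) (enum_fset (val p)) (weval v).

Definition satisfies (S : caisemiring) (p q : poly) : Prop :=
  forall v : var -> S, peval v p = peval v q.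

Definition valid_in (V : caiclass) (p q : poly) : Prop :=
  forall S : caisemiring, V S -> satisfies S p q.

(* The endomorphism extending phi is evaluation in the free algebra itself. *)
Definition subst (phi : var -> poly) (p : poly) : poly :=
  @peval free_cai phi p.

Definition ctx_mul (K : option poly) (p : poly) : poly :=
  if K is Some k then pmul k p else p.

Definition ctx_add (p : poly) (R : option poly) : poly :=
  if R is Some t then padd p t else p.

Definition contextual_application (s : poly) (r : cword) (A B : poly) : Prop :=
  exists (phi : var -> poly) (K R : option poly),
    let Ks := ctx_mul K (subst phi s) in
    let Kr := ctx_mul K (subst phi (mono r)) in
    (A = ctx_add Ks R /\ B = ctx_add (padd Ks Kr) R) \/
    (A = ctx_add (padd Ks Kr) R /\ B = ctx_add Ks R).

Definition D : caisemiring :=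
  CaiSemiring (inhabits true) orbA orbC orbb andbA andbC andb_orl andb_orr.

Inductive Hcar : Type := H1 | Ha | Hinf.

Definition Hadd (u v : Hcar) : Hcar :=
  match u, v with
  | H1, t | t, H1 => t
  | Ha, Ha => Ha
  | _, _ => Hinf
  end.

Definition Hmul (u v : Hcar) : Hcar :=
  match u, v with
  | H1, t | t, H1 => t
  | _, _ => Hinf
  end.

Fact HaddA : associative Hadd. Proof. by do 3!case. Qed.
Fact HaddC : commutative Hadd. Proof. by do 2!case. Qed.
Fact Haddxx : idempotent_op Hadd. Proof. by case. Qed.
Fact HmulA : associative Hmul. Proof. by do 3!case. Qed.
Fact HmulC : commutative Hmul. Proof. by do 2!case. Qed.
Fact HmulDl : left_distributive Hmul Hadd. Proof. by do 3!case. Qed.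
Fact HmulDr : right_distributive Hmul Hadd. Proof. by do 3!case. Qed.

Definition H : caisemiring :=
  CaiSemiring (inhabits H1) HaddA HaddC Haddxx HmulA HmulC HmulDl HmulDr.

Inductive Gcar : Type := G1 | Gg | Ginf.

Definition Gadd (u v : Gcar) : Gcar :=
  match u, v with
  | G1, G1 => G1
  | Gg, Gg => Gg
  | _, _ => Ginf
  end.

Definition Gmul (u v : Gcar) : Gcar :=
  match u, v with
  | G1, t | t, G1 => t
  | Gg, Gg => G1
  | _, _ => Ginf
  end.

Fact GaddA : associative Gadd. Proof. by do 3!case. Qed.
Fact GaddC : commutative Gadd. Proof. by do 2!case. Qed.
Fact Gaddxx : idempotent_op Gadd. Proof. by case. Qed.
Fact GmulA : associative Gmul. Proof. by do 3!case. Qed.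
Fact GmulC : commutative Gmul. Proof. by do 2!case. Qed.
Fact GmulDl : left_distributive Gmul Gadd. Proof. by do 3!case. Qed.
Fact GmulDr : right_distributive Gmul Gadd. Proof. by do 3!case. Qed.

Definition G : caisemiring :=
  CaiSemiring (inhabits G1) GaddA GaddC Gaddxx GmulA GmulC GmulDl GmulDr.

Definition W : caiclass :=
  generated_variety (fun S => [\/ S = H, S = D | S = G]).

(* The families x and y are indexed from 1, as in x_1, ..., x_n. *)
Definition wp (n : nat) (x : nat -> var) : cword :=
  seq_word (x 1) [seq x i | i <- index_iota 2 n.+1].

Definition wa (x : nat -> var) (z : var) : cword := seq_word (x 1) [:: z].

Definition wq (n : nat) (x : nat -> var) (z : var) : cword :=
  wmul (wp n x) (seq_word z [::]).

Definition wb (x y : nat -> var) (z : var) (i : nat) : cword :=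
  seq_word (x i) [:: y i; y i.+1; z].

Fact Upoly_subproof (n : nat) (x y : nat -> var) (z : var) :
  ([fset wp n x; wa x z] `|` [fset wb x y z i | i in index_iota 1 n.+1])
    != fset0.
Proof. by apply/fset0Pn; exists (wp n x); rewrite in_fsetU fset21. Qed.
Definition Upoly (n : nat) (x y : nat -> var) (z : var) : poly :=
  Sub ([fset wp n x; wa x z] `|`
       [fset wb x y z i | i in index_iota 1 n.+1])
      (Upoly_subproof n x y z).

(* Main.v *)
Require Import Defs.
From mathcomp Require Import all_boot zify.
From mathcomp.finmap Require Import finmap multiset.

(* Write q_n = k * prod tau(v), the product over the variables v of r, with k a
   word of the context and tau(v) a word of phi(v).  Since the words of U_n and
   U_n + q_n are squarefree, r is linear.  Validity in H, evaluated at a on two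
   variables u, v of r and at 1 elsewhere, shows that some word of s has total
   degree at least 2 in u, v; squarefreeness forces it to contain both, so
   k tau(u) tau(v) divides a word of U_n.  A word of U_n containing z contains
   at most one x_i, which forces k to be empty and every tau(v) to be a single
   letter, so that r has n + 1 variables.  If r has only one variable, validity
   in D gives a word of s in that variable alone, hence a word of U_n divisible
   by q_n, which is absurd. *)

Set Implicit Arguments.
Unset Strict Implicit.
Unset Printing Implicit Defensive.

Local Open Scope fset_scope.

(** * Evaluation of words and polynomials *)

Lemma bigne_ind (T I : Type) (op : T -> T -> T) (opA : associative op)
    (opC : commutative op) (x0 : T) (F : I -> T) (R : T -> seq I -> Prop) :
    (forall i, R (F i) [:: i]) ->
    (forall i s t, R t s -> R (op (F i) t) (i :: s)) ->
  forall s, ~~ nilp s -> R (bigne opA opC x0 s F) s.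
Proof.
move=> R1 RS s s0.
(* On a nonempty sequence the fold is a [Some], so the default [x0] is never returned; hence the
   induction starts at singletons. *)
suff [t E Rt] : exists2 t,
    \big[oAC opA opC/None]_(i <- s) Some (F i) = Some t & R t s.
  by rewrite /bigne E.
elim: s s0 => // i [|j s] IHs _; rewrite big_cons.
  by exists (F i); rewrite ?big_nil.
by have [t -> Rt] := IHs isT; exists (op (F i) t); rewrite ?oACE //; apply: RS.
Qed.

Lemma weval_ind (S : caisemiring) (v : var -> S) (R : S -> seq var -> Prop) :
    (forall i, R (v i) [:: i]) ->
    (forall i s t, R t s -> R (smul (v i) t) (i :: s)) ->
  forall w : cword, R (weval v w) (enum_mset (val w)).
Proof.
by move=> R1 RS w; apply: bigne_ind => //; rewrite /nilp size_mset_eq0 (valP w).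
Qed.

(** A property that a sum has exactly when a summand has it can be tested word by word. It is
    applied to containing a given word, to being true in [D] and to being [Hinf] in [H]. *)
Lemma peval_prime (S : caisemiring) (P : S -> Prop) :
    (forall a b, P (sadd a b) <-> P a \/ P b) ->
  forall (v : var -> S) (p : poly),
    P (peval v p) <-> exists2 w, w \in val p & P (weval v w).
Proof.
move=> PD v p; rewrite /peval.
have: ~~ nilp (enum_fset (val p)).
  case/fset0Pn: (valP p) => w; rewrite -[_ \in _]/(w \in enum_fset (val p)).
  by case: enum_fset.
apply: (@bigne_ind _ _ _ _ _ _ _ (fun t s =>
  P t <-> exists2 w, w \in s & P (weval v w))) => [w|w s t IH].
  by split=> [Pw|[w' /[!inE] /eqP-> //]]; exists w; rewrite ?inE.
rewrite PD IH; split=> [[Pw|[w' ws Pw]]|[w' /[!inE] /orP[/eqP->|ws] Pw]].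
- by exists w; rewrite ?inE ?eqxx.
- by exists w'; rewrite ?inE ?ws ?orbT.
- by left.
- by right; exists w'.
Qed.

(** * Words of substituted polynomials and of contexts *)

Lemma in_substP (phi : var -> poly) (p : poly) (u : cword) :
  u \in val (subst phi p) <->
  exists2 w, w \in val p & u \in val (@weval free_cai phi w).
Proof.
apply: (@peval_prime free_cai (fun t => u \in val (t : poly))) => a b.
by rewrite in_fsetU; split=> [/orP|?]; last apply/orP.
Qed.

Lemma weval_free_choice (phi : var -> poly) (tau : var -> cword) :
    (forall v, tau v \in val (phi v)) ->
  forall w : cword, exists2 u, u \in val (@weval free_cai phi w : poly) &
    forall c, val u c = \sum_(v <- enum_mset (val w)) val (tau v) c.
Proof.
move=> tauP; apply: (@weval_ind free_cai phi (fun t l =>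
  exists2 u, u \in val (t : poly) &
    forall c, val u c = \sum_(v <- l) val (tau v) c)) => [i|i s t [u ut uE]].
  by exists (tau i) => // c; rewrite big_seq1.
exists (wmul (tau i) u); first exact: in_imfset2.
by move=> c; rewrite big_cons -uE msetE2.
Qed.

Lemma poly_choice (phi : var -> poly) :
  exists tau, forall v, tau v \in val (phi v).
Proof.
exists (fun v => xchoose (fset0Pn _ (valP (phi v)))) => v.
exact: xchooseP.
Qed.

(** Linearity of [w] matters: two occurrences of one variable could contribute different words of
    its image, which no single [tau] would describe. *)
Lemma weval_free_split (phi : var -> poly) (w u : cword) :
    uniq (enum_mset (val w)) -> u \in val (@weval free_cai phi w : poly) ->
  exists tau, (forall v, tau v \in val (phi v)) /\
    forall c, val u c = \sum_(v <- enum_mset (val w)) val (tau v) c.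
Proof.
move: w u; apply: (@weval_ind free_cai phi (fun t s => forall u,
  uniq s -> u \in val (t : poly) -> exists tau,
  (forall v, tau v \in val (phi v)) /\
  forall c, val u c = \sum_(v <- s) val (tau v) c)) => [i u _ ui|i s t IH u].
  have [tau tauP] := poly_choice phi.
  exists (fun v => if v == i then u else tau v); split=> [v|c].
    by case: eqP => [->|].
  by rewrite big_seq1 eqxx.
rewrite cons_uniq => /andP[is0 us] /in_pmulP[a [b [ai bt ->]]].
have [tau [tauP tauE]] := IH b us bt.
exists (fun v => if v == i then a else tau v); split=> [v|c].
  by case: eqP => [->|].
rewrite msetE2 tauE big_cons eqxx; congr addn.
by apply: eq_big_seq => v vs; case: eqP vs is0 => // -> ->.
Qed.

(** An absent context acts as the empty multiset, so [kk] is not a [cword]. The factor found for one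
    polynomial may multiply the words of any other. *)
Lemma ctx_mul_split (K : option poly) (p : poly) (w : cword) :
    w \in val (ctx_mul K p) ->
  exists kk : {mset var}%mset,
    (exists2 u, u \in val p & val w = (kk `+` val u)%mset) /\
    forall p' u', u' \in val p' ->
         exists2 w', w' \in val (ctx_mul K p') & val w' = (kk `+` val u')%mset.
Proof.
case: K => [k|] /= => [/in_pmulP[a [u [ak up ->]]]|wp].
  exists (val a); split; first by exists u.
  by move=> p' u' u'p; exists (wmul a u') => //; apply: in_imfset2.
exists mset0; split; first by exists w; rewrite // mset0D.
by move=> p' u' u'p; exists u'; rewrite // mset0D.
Qed.

Lemma in_ctx_add (p : poly) (R : option poly) (w : cword) :
  (w \in val (ctx_add p R)) =
  (w \in val p) || (if R is Some t then w \in val t else false).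
Proof. by case: R => [t|] /=; rewrite ?in_fsetU ?orbF. Qed.

(** * Consequences of validity in [D] and [H] *)

Lemma W_satisfies (S : caisemiring) (p q : poly) :
  valid_in W p q -> [\/ S = H, S = D | S = G] -> satisfies S p q.
Proof. by move=> pq SC; apply: pq => V _; apply. Qed.

Lemma weval_D (A : pred var) (w : cword) :
  @weval D A w = all A (enum_mset (val w)).
Proof.
by apply: (@weval_ind D A (fun t l => t = all A l)) => [i|i s t ->] //=;
  rewrite andbT.
Qed.

(** Set the variables of [r] to true and all others to false: [r] becomes true, hence so does some
    word of [s]. *)
Lemma absorb_D (s : poly) (r : cword) : satisfies D (padd s (mono r)) s ->
  exists2 w, w \in val s & {subset enum_mset (val w) <= enum_mset (val r)}.
Proof.
move=> /(_ [in enum_mset (val r)]).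
have PD : forall a b : D, is_true (sadd a b) <-> is_true a \/ is_true b.
  by move=> a b; split=> [/orP|?]; last apply/orP.
move=> E.
have: is_true (@peval D [in enum_mset (val r)] (padd s (mono r))).
  apply/(peval_prime PD); exists r; first by rewrite in_fsetU in_fset1 eqxx orbT.
  by rewrite weval_D; apply/allP.
rewrite E => /(peval_prime PD)[w ws]; rewrite weval_D => /allP wr.
by exists w.
Qed.

Lemma weval_H (A : pred var) (w : cword) :
  @weval H (fun v => if A v then Ha else H1) w =
  match count A (enum_mset (val w)) with 0 => H1 | 1 => Ha | _ => Hinf end.
Proof.
apply: (@weval_ind H _ (fun t l =>
  t = match count A l with 0 => H1 | 1 => Ha | _ => Hinf end))
  => [i|i s t ->] /=; first by case: (A i).
by case: (A i); case: (count A s) => [|[]].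
Qed.

(** In [H] a sum is [Hinf] only if a summand is, and with [A] sent to [Ha] and the rest to [H1] a
    word is [Hinf] exactly when its degree in [A] is at least two. *)
Lemma absorb_H (s : poly) (r : cword) (A : pred var) :
    satisfies H (padd s (mono r)) s -> 1 < count A (enum_mset (val r)) ->
  exists2 w, w \in val s & 1 < count A (enum_mset (val w)).
Proof.
move=> /(_ (fun v => if A v then Ha else H1)) E rA.
have PD : forall a b : H, sadd a b = Hinf :> H <-> a = Hinf \/ b = Hinf.
  by do 2!case; split=> //=; auto; case.
have: peval (S := H) (fun v => if A v then Ha else H1) (padd s (mono r)) = Hinf.
  apply/(peval_prime PD); exists r; first by rewrite in_fsetU in_fset1 eqxx orbT.
  by rewrite weval_H; case: count rA => [|[]].
rewrite E => /(peval_prime PD)[w ws]; rewrite weval_H => wA.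
by exists w => //; case: count wA => [|[]].
Qed.

(** [a] and [b] are two occurrences and may be equal as letters. *)
Lemma count_gt1P (T : eqType) (A : pred T) (l : seq T) :
  1 < count A l -> exists a b l', [/\ A a, A b & perm_eq l [:: a, b & l']].
Proof.
move=> lA; have /hasP[a al Aa]: has A l by rewrite has_count ltnW.
have E := perm_to_rem al; move: lA.
rewrite (permP E) /= Aa add1n ltnS -has_count => /hasP[b bl Ab].
exists a, b, (rem b (rem a l)); split=> //.
by rewrite (permPl E) perm_cons perm_to_rem.
Qed.

(** * Letters of the words of [U_n] and of [q_n] *)

Lemma seq_wordE (a : var) (s : seq var) (c : var) :
  val (seq_word a s) c = count_mem c (a :: s).
Proof. exact: mset_seqE. Qed.

Lemma wpE (n : nat) (x : nat -> var) (c : var) : 0 < n ->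
  val (wp n x) c = count_mem c [seq x i | i <- index_iota 1 n.+1].
Proof. by case: n => // n _; rewrite seq_wordE /index_iota !subSS !subn0. Qed.

Lemma wqE (n : nat) (x : nat -> var) (z c : var) : 0 < n ->
  val (wq n x z) c = count_mem c (z :: [seq x i | i <- index_iota 1 n.+1]).
Proof. by move=> n0; rewrite msetE2 wpE // seq_wordE /= addn0 addnC. Qed.

Lemma in_UpolyP (n : nat) (x y : nat -> var) (z : var) (w : cword) :
  w \in val (Upoly n x y z) ->
  [\/ w = wp n x, w = wa x z
    | exists2 i, i \in index_iota 1 n.+1 & w = wb x y z i].
Proof.
rewrite in_fsetU in_fset2 -orbA => /or3P[/eqP->|/eqP->|/imfsetP[i /= iI ->]].
- by constructor 1.
- by constructor 2.
- by constructor 3; exists i.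
Qed.

Lemma in_padd_mono (p : poly) (r w : cword) :
  (w \in val (padd p (mono r))) = (w \in val p) || (w == r).
Proof. by rewrite in_fsetU in_fset1. Qed.

Lemma uniq_map_inj (T1 T2 : eqType) (f : T1 -> T2) (s : seq T1) :
  uniq [seq f i | i <- s] -> {in s &, injective f}.
Proof.
elim: s => //= a s IH /andP[fas us] i j.
rewrite !inE => /predU1P[->|is_] /predU1P[->|js] // E; last exact: IH.
  by rewrite E map_f in fas.
by rewrite -E map_f in fas.
Qed.

(** The delicate words are the [b_i], where [y i] and [y i.+1] must differ; at [i = n] the latter is
    [y 1], distinct from [y n] because [1 < n]. *)
Lemma Uq_squarefree (n : nat) (x y : nat -> var) (z : var) :
    1 < n ->
    uniq (z :: [seq x i | i <- index_iota 1 n.+1] ++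
               [seq y i | i <- index_iota 1 n.+1]) ->
    y n.+1 = y 1 ->
  forall w c, w \in val (padd (Upoly n x y z) (mono (wq n x z))) -> val w c <= 1.
Proof.
move=> n1 + yn w c; have n0 := ltnW n1.
rewrite cons_uniq mem_cat cat_uniq negb_or
  => /and3P[/andP[zx zy] ux /andP[xy uy]].
have ule (l : seq var) : uniq l -> count_mem c l <= 1.
  by move=> ul; rewrite count_uniq_mem // leq_b1.
have I1 : 1 \in index_iota 1 n.+1 by rewrite mem_index_iota.
rewrite in_padd_mono => /orP[/in_UpolyP[->|->|[i iI ->]]|/eqP->].
- by rewrite wpE // ule.
- rewrite seq_wordE ule //= inE andbT.
  by apply: contraNneq zx => <-; apply: map_f.
- rewrite seq_wordE ule //=.
  have [i' i'I [-> ii']]: exists2 i', i' \in index_iota 1 n.+1 &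
      y i.+1 = y i' /\ i != i'.
    move: iI; rewrite mem_index_iota ltnS => /andP[i0 lein].
    have [->|nin] := eqVneq i n.
      by exists 1; rewrite // yn; split=> //; rewrite eq_sym ltn_eqF.
    exists i.+1; last by rewrite ltn_eqF.
    by rewrite mem_index_iota !ltnS ltn_neqAle nin.
  have xny j : j \in index_iota 1 n.+1 -> x i != y j.
    move=> jI; apply: contraNneq xy => xiyj; apply/hasP; exists (y j).
      exact: map_f.
    by rewrite -xiyj; apply: map_f.
  rewrite !inE !negb_or !xny //= andbT -!andbA; apply/and4P; split.
  + by apply: contraNneq zx => <-; apply: map_f.
  + by apply: contraNneq ii' => /(uniq_map_inj uy)->.
  + by apply: contraNneq zy => <-; apply: map_f.
  + by apply: contraNneq zy => <-; apply: map_f.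
- by rewrite wqE // ule //= zx.
Qed.

(** [p_n] lacks [z], while [a_n] has only [x_1] and [b_i] only [x_i] among the x-letters. *)
Lemma U_zxx (n : nat) (x y : nat -> var) (z : var) :
    0 < n ->
    uniq (z :: [seq x i | i <- index_iota 1 n.+1] ++
               [seq y i | i <- index_iota 1 n.+1]) ->
    y n.+1 = y 1 ->
  forall w c d, w \in val (Upoly n x y z) ->
    c \in [seq x i | i <- index_iota 1 n.+1] ->
    d \in [seq x i | i <- index_iota 1 n.+1] ->
    0 < val w z -> 0 < val w c -> 0 < val w d -> c = d.
Proof.
move=> n0 + yn w c d.
rewrite cons_uniq mem_cat cat_uniq negb_or
  => /and3P[/andP[zx zy] ux /andP[xy uy]].
move=> wU cx dx.
have xz e : e \in [seq x i | i <- index_iota 1 n.+1] -> (e == z) = false.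
  by move=> ex; apply: contraNF zx => /eqP<-.
have yI i : i \in index_iota 1 n.+1.+1 ->
    y i \in [seq y i | i <- index_iota 1 n.+1].
  rewrite mem_index_iota ltnS (leq_eqVlt i) => /andP[i0 /orP[/eqP->|ilt]].
    by rewrite yn map_f // mem_index_iota.
  by rewrite map_f // mem_index_iota i0.
have xny e i : e \in [seq x i | i <- index_iota 1 n.+1] ->
    i \in index_iota 1 n.+1.+1 -> (e == y i) = false.
  move=> ex /yI yi; apply: contraNF xy => /eqP eyi.
  by apply/hasP; exists (y i); rewrite // -eyi.
case: (in_UpolyP wU) => [->|->|[i iI ->]].
- by rewrite wpE // -has_count has_pred1 (negPf zx).
- rewrite !seq_wordE -!has_count !has_pred1 !inE (xz c) // (xz d) // !orbF.
  by move=> _ /eqP-> /eqP->.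
- have [iI' siI]: i \in index_iota 1 n.+2 /\ i.+1 \in index_iota 1 n.+2.
    move: iI; rewrite !mem_index_iota !ltnS => /andP[i0 lein].
    by rewrite i0 lein leqW.
  rewrite !seq_wordE -!has_count !has_pred1 !inE (xz c) // (xz d) //.
  rewrite !(xny c) // !(xny d) // !orbF.
  by move=> _ /eqP-> /eqP->.
Qed.

(** * Counting letters in products of images *)

Lemma leq_sum_seq1 (T : eqType) (l : seq T) (F : T -> nat) (a : T) :
  a \in l -> F a <= \sum_(i <- l) F i.
Proof. by move=> al; rewrite (perm_big _ (perm_to_rem al)) big_cons leq_addr. Qed.

Lemma leq_sum_seq2 (T : eqType) (l l' : seq T) (F : T -> nat) (a b : T) :
  perm_eq l [:: a, b & l'] -> F a + F b <= \sum_(i <- l) F i.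
Proof. by move=> E; rewrite (perm_big _ E) !big_cons /= addnA leq_addr. Qed.

Lemma ltn1_addn (k a m : nat) : 0 < a -> a + a <= m -> 1 < k + m.
Proof. lia. Qed.

Lemma cword_letter (w : cword) : exists c, 0 < val w c.
Proof.
case: (fset_0Vmem (finsupp (val w))) => [w0|[c cw]].
  case/eqP: (valP w); apply/msetP => c; rewrite mset0E.
  by apply: fsfun_dflt; rewrite w0.
by exists c; rewrite lt0n -mem_finsupp.
Qed.

(* The function tau v records the letters of the image of v and kk those of the
   context.  Whenever z occurs in the product of the context with two images,
   that product has at most one other letter, so all images are single letters
   and the context is empty. *)
Lemma letters_bound (T : choiceType) (L : seq T) (kk : T -> nat)
    (tau : T -> T -> nat) (z : T) (xs : seq T) (u0 : T) :
    uniq (z :: xs) -> u0 \in L -> (forall v, exists c, 0 < tau v c) ->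
    (forall c, c \in z :: xs <-> 0 < kk c \/ exists2 v, v \in L & 0 < tau v c) ->
    (forall u, u \in L -> exists2 v, v \in L & v != u) ->
    (forall u v c, u \in L -> v \in L -> v != u ->
       kk c + tau u c + tau v c <= 1) ->
    (forall u v c d, u \in L -> v \in L -> v != u -> c \in xs -> d \in xs ->
       0 < kk z + tau u z + tau v z -> 0 < kk c + tau u c + tau v c ->
       0 < kk d + tau u d + tau v d -> c = d) ->
  size (z :: xs) <= size L.
Proof.
move=> uzx u0L tau0 supp other sqf zxx.
have [h hP]: exists h, forall v, 0 < tau v (h v).
  by exists (fun v => xchoose (tau0 v)) => v; apply: (xchooseP (tau0 v)).
have hin v : v \in L -> h v = z \/ h v \in xs.
  by move=> vL; apply/predU1P; rewrite -in_cons; apply/supp; right; exists v.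
(* Were [z] in the context, letters chosen from two images would be x-letters beside [z], hence
   equal, against squarefreeness. *)
have [u uL uz]: exists2 u, u \in L & 0 < tau u z.
  have [kz|//] := (supp z).1 (mem_head _ _).
  have [v0 v0L v0u] := other _ u0L.
  have hx v w : v \in L -> w \in L -> w != v -> h v \in xs /\ h w \in xs.
    move=> vL wL wv; have := sqf v w z vL wL wv.
    case: (hin v vL) (hP v) => [->|-> _].
      by lia.
    case: (hin w wL) (hP w) => [->|-> //].
    by lia.
  have [hu hv] := hx _ _ u0L v0L v0u.
  have E : h u0 = h v0.
    by apply: (zxx u0 v0); rewrite ?addn_gt0 ?kz ?hP ?orbT.
  by have := sqf u0 v0 (h u0) u0L v0L v0u; have := hP v0; have := hP u0;
    rewrite -E; lia.
have zh v : v \in L -> v != u -> h v \in xs.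
  move=> vL vu; have := sqf u v z uL vL vu.
  by case: (hin v vL) (hP v) => [->|//]; lia.
have X v c : v \in L -> v != u -> c \in xs -> 0 < kk c + tau u c + tau v c ->
    c = h v.
  move=> vL vu cx c0; apply: (zxx u v) => //; first exact: zh.
    by rewrite !addn_gt0 uz orbT.
  by rewrite !addn_gt0 hP !orbT.
(* Such a letter would also be [h v] for a second variable [v], and so occur twice. *)
have X0 c : c \in xs -> (kk c + tau u c = 0)%N.
  move=> cx; apply/eqP; rewrite -leqn0 leqNgt; apply/negP => c0.
  have [v vL vu] := other u uL.
  have E : c = h v by apply: X; rewrite // addn_gt0 c0.
  by have := sqf u v c uL vL vu; have := hP v; rewrite -E; lia.
have hu : h u = z.
  by case: (hin u uL) (hP u) => // /X0; lia.
(* Every letter of [z :: xs] is some [h v]: [z] is [h u], and an x-letter lies in the image of a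
   variable other than [u]. *)
rewrite -(size_map h L); apply: uniq_leq_size => // c.
move=> cq; apply/mapP; move: cq; rewrite inE => /predU1P[->|cx].
  by exists u.
have [k0|[v vL vc]] := (supp c).1 (mem_behead (s := z :: xs) cx).
  by have := X0 c cx; lia.
exists v => //; apply: X => //; last by rewrite addn_gt0 vc orbT.
apply: contraTneq vc => ->.
by have := X0 c cx; lia.
Qed.

(** * From an application of the identity to the letters of [q_n] *)

Theorem lemma6p1 (n : nat) (x y : nat -> var) (z : var) (s : poly) (r : cword) :
  5 <= n -> odd n ->
  uniq (z :: [seq x i | i <- index_iota 1 n.+1] ++
             [seq y i | i <- index_iota 1 n.+1]) ->
  y n.+1 = y 1 ->
  valid_in W (padd s (mono r)) s ->
  contextual_application s r
    (Upoly n x y z) (padd (Upoly n x y z) (mono (wq n x z))) ->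
  n.+1 <= #|` wvars r|.
Proof.
move=> n5 _ uq yn sr [phi [K [R]]].
set U := Upoly n x y z; set q := wq n x z => /= app.
have n1 : 1 < n by apply: leq_trans n5.
have n0 := ltnW n1.
set xs := [seq x i | i <- index_iota 1 n.+1].
have uzx : uniq (z :: xs).
  by move: uq; rewrite -cat_cons cat_uniq => /andP[].
have qE c : val q c = (c \in z :: xs) by rewrite wqE // count_uniq_mem.
have sqf := Uq_squarefree n1 uq yn.
have zxx := U_zxx n0 uq yn.
have Uq w : w \in val U -> w \in val (padd U (mono q)).
  by rewrite in_padd_mono => ->.
(* A word of [U_n] with all letters of [q_n] would contain [x_1] and [x_2] beside [z]. *)
have noq w : w \in val U -> (forall c, 0 < val q c -> 0 < val w c) -> False.
  move=> wU qw.
  have xi i : 0 < i <= n -> x i \in xs.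
    by move=> iP; apply: map_f; rewrite mem_index_iota ltnS.
  have x12 : x 1 = x 2.
    by apply: (zxx w); rewrite ?xi //; apply: qw;
      rewrite qE lt0b inE ?eqxx // xi ?orbT.
  case/andP: uzx => _ /uniq_map_inj /(_ 1 2).
  by rewrite !mem_index_iota /= !ltnS n0 n1 => /(_ isT isT x12).
have [SU RUq qR] : [/\
    forall w, w \in val (ctx_mul K (subst phi s)) -> w \in val U,
    forall w, w \in val (ctx_mul K (subst phi (mono r))) ->
      w \in val (padd U (mono q))
  & q \in val (ctx_mul K (subst phi (mono r)))].
  have qUq : q \in val (padd U (mono q)) by rewrite in_padd_mono eqxx orbT.
  case: app => -[UE qUE].
    split=> [w wS|w wR|].
    - by rewrite UE in_ctx_add wS.
    - by rewrite qUE in_ctx_add in_fsetU wR orbT.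
    - move: qUq; rewrite qUE in_ctx_add in_fsetU -orbA orbCA => /orP[//|].
      by rewrite -in_ctx_add -UE => /noq[].
  (* In the reverse order every word of [U_n + q_n], even [q_n], would lie in [U_n]. *)
  case: (noq q) => //; move: qUq; rewrite qUE UE !in_ctx_add in_fsetU.
  by case/orP => ->; rewrite ?orbT.
have [kk [[u0 u0r qku] lift]] := ctx_mul_split qR.
(* The factor [kk] of [q_n] also multiplies words of [phi(s)]; this carries letters of [q_n] into
   words of [U_n]. *)
have {}lift tau p t : (forall v, tau v \in val (phi v)) -> t \in val p ->
    exists2 w, w \in val (ctx_mul K (subst phi p)) &
      forall c, val w c = (kk c + \sum_(v <- enum_mset (val t)) val (tau v) c)%N.
  move=> tauP tp; have [u ut uE] := weval_free_choice tauP t.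
  have [|w wK wE] := lift (subst phi p) u; first by apply/in_substP; exists t.
  by exists w => // c; rewrite wE msetE2 uE.
have rr : r \in val (mono r) by rewrite in_fset1.
set L := enum_mset (val r).
(* A repeated variable, given the same word at both occurrences, would repeat a letter in a word of
   [K phi(r)]. *)
have uL : uniq L.
  apply: count_mem_uniq => v; case: (posnP (count_mem v L)) => [v0|v0].
    by rewrite v0 -has_pred1 has_count v0.
  suff v1 : count_mem v L <= 1.
    by rewrite -has_pred1 has_count v0; apply/eqP; rewrite eqn_leq v1.
  rewrite leqNgt; apply/negP => /count_gt1P[_ [_ [l [/eqP-> /eqP-> E]]]].
  have [tau tauP] := poly_choice phi.
  have [w wR wE] := lift tau _ r tauP rr.
  have [c cv] := cword_letter (tau v).
  have := sqf w c (RUq _ wR); rewrite wE leqNgt => /negP; apply.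
  exact: ltn1_addn cv (leq_sum_seq2 (fun v => val (tau v) c) E).
have [tau [tauP tauE]] : exists tau, (forall v, tau v \in val (phi v)) /\
    forall c, val u0 c = \sum_(v <- L) val (tau v) c.
  apply: weval_free_split => //.
  by have [r'] := (in_substP _ _ _).1 u0r; rewrite in_fset1 => /eqP->.
have supp c : c \in z :: xs <->
    0 < kk c \/ exists2 v, v \in L & 0 < val (tau v) c.
  have -> : (c \in z :: xs) = (0 < kk c + \sum_(v <- L) val (tau v) c).
    by rewrite -tauE -[c \in _]lt0b -qE qku msetE2.
  rewrite addn_gt0; split=> [/orP[->|]|[->//|[v vL cv]]]; first by left.
    rewrite lt0n sum_nat_seq_neq0 => /hasP[v vL /=]; rewrite -lt0n => cv.
    by right; exists v.
  by rewrite (leq_trans cv (leq_sum_seq1 (fun v => val (tau v) c) vL)) orbT.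
have [a aL]: exists a, a \in L.
  have [a ar] := cword_letter r.
  by exists a; rewrite -has_pred1 has_count count_mem_mset.
(* If [u] were alone, [D] would give a word of [s] in [u] only, hence a word of [U_n] with all
   letters of [q_n]. *)
have other u : u \in L -> exists2 v, v \in L & v != u.
  move=> _; apply/hasP; apply/negPn/negP; rewrite -all_predC => /allP Lu.
  have [w ws wr] := absorb_D (W_satisfies sr (Or32 _ _ erefl)).
  have [w' w'S w'E] := lift tau s w tauP ws.
  apply: (noq w' (SU _ w'S)) => c; rewrite qE lt0b => /supp.
  rewrite w'E addn_gt0 => -[->//|[v vL vc]]; apply/orP; right.
  have [b bw] := cword_letter w.
  have bW : b \in enum_mset (val w).
    by rewrite -has_pred1 has_count count_mem_mset.
  apply: leq_trans (leq_sum_seq1 (fun v => val (tau v) c) bW).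
  by have:= Lu _ (wr _ bW); have := Lu _ vL; rewrite /= !negbK => /eqP <- /eqP->.
have pair u v : u \in L -> v \in L -> v != u -> exists2 w, w \in val U &
    forall c, kk c + val (tau u) c + val (tau v) c <= val w c.
  move=> uinL vL vu.
  have [|t ts] := @absorb_H s r (pred2 u v) (W_satisfies sr (Or31 _ _ erefl)).
    rewrite (permP (perm_to_rem uinL)) /= eqxx add1n ltnS -has_count.
    by apply/hasP; exists v; rewrite ?mem_rem_uniq //= ?inE ?vu ?eqxx ?orbT.
  move=> /count_gt1P[b [d [l [bP dP E]]]].
  have [w wS wE] := lift tau s t tauP ts.
  exists w; first exact: SU.
  (* Two occurrences of one variable would repeat a letter in [w]; so [b] and [d] are [u] and [v] in
     some order. *)
  have bd : b != d.
    apply/eqP => bd; have [c cb] := cword_letter (tau b).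
    have := sqf w c (Uq _ (SU _ wS)); rewrite wE leqNgt => /negP; apply.
    by apply: (ltn1_addn _ cb); move: E; rewrite -bd; apply: leq_sum_seq2.
  move=> c; rewrite wE -addnA leq_add2l.
  apply: leq_trans (leq_sum_seq2 (fun v => val (tau v) c) E).
  by case/pred2P: bP bd => ->; case/pred2P: dP => ->; rewrite ?eqxx //= addnC.
have -> : #|` wvars r| = size L.
  by rewrite -(perm_size (perm_undup_mset _)) undup_id.
have -> : n.+1 = size (z :: xs) by rewrite /= size_map size_iota subn1.
apply: (@letters_bound _ L kk (fun v => val (tau v)) z xs a) => //.
- by move=> v; apply: cword_letter.
- move=> u v c uinL vL vu; have [w wU wE] := pair u v uinL vL vu.
  exact: leq_trans (wE c) (sqf _ _ (Uq _ wU)).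
- move=> u v c d uinL vL vu cx dx; have [w wU wE] := pair u v uinL vL vu.
  by move=> z0 c0 d0; apply: (zxx w) => //; apply: leq_trans (wE _).
Qed.
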